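(* Let $\mathbb{F}$ be a field. Let $\phi$ range over a family of unsatisfiable CNF formulas in variables $x_1,\ldots,x_N$, with clauses $C_1,\ldots,C_M$, each clause written as $C=(\ell_1\vee\ell_2\vee\ell_3)$, such that every $\mathrm{roABP}$-$\mathrm{IPS}_{\mathrm{LIN}}$ refutation of $\phi$ over $\mathbb{F}$ in the variable ordering $x_1<\cdots<x_N$ has width at least $2^{N^{\Omega(1)}}$. Let $\Psi(\bar u,\bar v)=\Phi_1(\bar u,\bar v)\wedge\Phi_2(\bar u)$ be the lifted CNF constructed from $\phi$ as described in the context. Then every $\mathrm{roABP}$-$\mathrm{IPS}_{\mathrm{LIN}}$ refutation of $\Psi$ over $\mathbb{F}$, in any variable ordering of the variables of $\Psi$, has width at least $2^{N^{\Omega(1)}}$.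
   Context: An roABP (read-once oblivious algebraic branching program) in the variable ordering $x_1<\cdots<x_n$ is a sequence of matrices $M_1,\ldots,M_n$ whose entries in $M_i$ are univariate polynomials in $x_i$ (dimensions compatible); it computes the $(1,1)$ entry of $M_1\cdots M_n$. Its width is the maximal dimension of the matrices. The standard translation of a clause $C=\bigvee_{i\in I}x_i\vee\bigvee_{j\in J}\neg x_j$ is $\mathrm{tr}(C)=\prod_{i\in I}(1-x_i)\prod_{j\in J}x_j$, and of a CNF with clauses $C_1,\dots,C_m$ in variables $x_1,\dots,x_n$ it is the set $\{\mathrm{tr}(C_i):i\in[m]\}\cup\{x_i^2-x_i:i\in[n]\}$. An $\mathrm{roABP}$-$\mathrm{IPS}_{\mathrm{LIN}}$ refutation of a finite set $Q$ of polynomials (of a CNF: of its standard translation) in a given variable ordering is a family of polynomials $(g_q)_{q\in Q}$ with $\sum_{q\in Q}g_q\,q=1$ as formal polynomials, where each $g_q$ is computed by an roABP in that ordering; its width is the maximal width of these roABPs. Construction of $\Psi$: for a literal $\ell$, $\mathrm{var}(\ell)$ is its variable and $\mathrm{sg}(\ell)$ its sign; $v^{1}=v$, $v^{0}=\neg v$ (with the sign of $\ell$ copied). Introduce variables $\bar v=(v_1,\ldots,v_N)$, and for every clause $C$ of $\phi$ and every triple $(i,j,k)$ of distinct indices in $[N]$ a variable $u_{C,i,j,k}$; $\bar u$ is the tuple of all these. $\Phi_1$ is the conjunction, over all $C=(\ell_1\vee\ell_2\vee\ell_3)$ and all distinct $i,j,k$, of the clauses $\neg u_{C,i,j,k}\vee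 v_i^{\mathrm{sg}(\ell_1)}\vee v_j^{\mathrm{sg}(\ell_2)}\vee v_k^{\mathrm{sg}(\ell_3)}$. To $u_{C,i,j,k}$ associate the partial map $\pi_{C,i,j,k}=\{v_i\mapsto\mathrm{var}(\ell_1),v_j\mapsto\mathrm{var}(\ell_2),v_k\mapsto\mathrm{var}(\ell_3)\}$ from $\bar v$ to $\{x_1,\dots,x_N\}$; two such maps are incompatible if their union is not a one-to-one partial map (i.e. some $v$ is mapped to two different $x$'s, or two different $v$'s are mapped to the same $x$). $\Phi_2$ is the conjunction of: for every clause $C$, the clause $\bigvee_{i,j,k\text{ distinct}}u_{C,i,j,k}$ and, for every two distinct triples $(i,j,k)\neq(i',j',k')$, the clause $\neg u_{C,i,j,k}\vee\neg u_{C,i',j',k'}$; and for every two clauses $C,D$ and triples $(i,j,k),(a,b,c)$ of distinct indices such that $\pi_{C,i,j,k}$ and $\pi_{D,a,b,c}$ are incompatible, the clause $\neg u_{C,i,j,k}\vee\neg u_{D,a,b,c}$.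
   Formalization: The three literals of each clause of φ are assumed to be on three distinct variables; otherwise π_{C,i,j,k} is never one-to-one, it is incompatible with every other map, and Ψ has a constant-width refutation. *)

(* Defs.v *)
From HB Require Import structures.
From mathcomp Require Import all_boot all_order all_algebra finmap.
From mathcomp Require Import reals exp.
From mathcomp Require Import mpoly.

Set Implicit Arguments.
Unset Strict Implicit.
Unset Printing Implicit Defensive.

Import GRing.Theory.
Local Open Scope ring_scope.
Local Open Scope fset_scope.

(** * CNF formulas over a finite type of variables *)

(* The sign of a literal is [true] for [x] and [false] for [~ x]. *)
Definition literal (V : finType) : finType := (V * bool)%type.
Definition var (V : finType) (l : literal V) : V := l.1.
Definition sg (V : finType) (l : literal V) : bool := l.2.
Definition clause (V : finType) : finType := {set literal V}.
Definition cnf (V : finType) : finType := {set clause V}.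

Definition satisfies (V : finType) (a : V -> bool) (phi : cnf V) : Prop :=
  forall C, C \in phi -> exists2 l, l \in C & a (var l) = sg l.

Definition unsatisfiable (V : finType) (phi : cnf V) : Prop :=
  forall a : V -> bool, ~ satisfies a phi.

(** * Standard translation to polynomials *)

Notation poly_ring F V := {mpoly F[#|V|]}.

Definition pvar (F : fieldType) (V : finType) (x : V) : poly_ring F V :=
  'X_(enum_rank x).

Definition tr (F : fieldType) (V : finType) (C : clause V) : poly_ring F V :=
  \prod_(l in C) (if sg l then 1 - pvar F (var l) else pvar F (var l)).

Definition translation (F : fieldType) (V : finType) (phi : cnf V) :
    {fset poly_ring F V} :=
  [fset tr F C | C in phi] `|` [fset pvar F x ^+ 2 - pvar F x | x in V].

(** * Read-once oblivious algebraic branching programs *)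

Definition is_ordering (V : finType) (s : seq V) : bool := perm_eq s (enum V).

(* [abp F s a c]: one matrix per variable of [s], in the order of [s]; the
   first matrix has [a.+1] rows and the last one has [c.+1] columns.  All
   dimensions are positive, so that the (1,1) entry exists. *)
Inductive abp (F : fieldType) (V : finType) : seq V -> nat -> nat -> Type :=
| AbpNil a : abp F [::] a a
| AbpCons x s a b c :
    'M[{poly F}]_(a.+1, b.+1) -> abp F s b c -> abp F (x :: s) a c.

Fixpoint abp_mx (F : fieldType) (V : finType) (s : seq V) (a c : nat)
    (P : abp F s a c) : 'M[poly_ring F V]_(a.+1, c.+1) :=
  match P with
  | AbpNil a => 1%:M
  | AbpCons x s a b c M P' => map_mx (horner_alg (pvar F x)) M *m abp_mx P'
  end.

Fixpoint abp_width (F : fieldType) (V : finType) (s : seq V) (a c : nat)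
    (P : abp F s a c) : nat :=
  match P with
  | AbpNil a => a.+1
  | AbpCons x s a b c M P' => maxn a.+1 (abp_width P')
  end.

Record roABP (F : fieldType) (V : finType) (s : seq V) : Type := RoABP {
  roABP_rows : nat;
  roABP_cols : nat;
  roABP_abp : abp F s roABP_rows roABP_cols
}.

Definition roABP_poly (F : fieldType) (V : finType) (s : seq V)
    (P : roABP F s) : poly_ring F V :=
  abp_mx (roABP_abp P) ord0 ord0.

Definition roABP_width (F : fieldType) (V : finType) (s : seq V)
    (P : roABP F s) : nat :=
  abp_width (roABP_abp P).

(** * roABP-IPS_LIN refutations *)

(* The families are total functions, of which only the values on [Q] matter. *)
Record refutation (F : fieldType) (V : finType) (s : seq V)
    (Q : {fset poly_ring F V}) : Type := Refutation {
  ref_coef : poly_ring F V -> poly_ring F V;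
  ref_roABP : poly_ring F V -> roABP F s;
  ref_computes : forall q, q \in Q -> roABP_poly (ref_roABP q) = ref_coef q;
  ref_sum : \sum_(q <- Q) ref_coef q * q = 1
}.

Definition ref_width (F : fieldType) (V : finType) (s : seq V)
    (Q : {fset poly_ring F V}) (r : refutation s Q) : nat :=
  \max_(q <- Q) roABP_width (ref_roABP r q).

(** * The lifted formula *)

(* A clause together with the order in which its three literals are written. *)
Definition clause3 (N : nat) : finType := 3.-tuple (literal 'I_N).

Definition cnf_of (N : nat) (phi : {set clause3 N}) : cnf 'I_N :=
  [set [set l in (C : clause3 N)] | C in phi].

Section Lift.

Variables (N : nat) (phi : {set clause3 N}).

Definition triple : finType := {t : 3.-tuple 'I_N | uniq t}.

Definition u_index : finType := ({C : clause3 N | C \in phi} * triple)%type.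

Definition lift_var : finType := (u_index + 'I_N)%type.

Definition uvar (p : u_index) : lift_var := inl p.
Definition vvar (i : 'I_N) : lift_var := inr i.

Definition Phi1_clause (p : u_index) : clause lift_var :=
  (uvar p, false) |:
    [set (vvar (tnth (val p.2) k), sg (tnth (val p.1) k)) | k : 'I_3].

Definition Phi1 : cnf lift_var := [set Phi1_clause p | p : u_index].

(* The graph of the partial map [pi_{C,i,j,k}]. *)
Definition pi_map (p : u_index) : {set 'I_N * 'I_N} :=
  [set (tnth (val p.2) k, var (tnth (val p.1) k)) | k : 'I_3].

Definition one_to_one (g : {set 'I_N * 'I_N}) : bool :=
  [forall e in g, forall e' in g, (e.1 == e'.1) == (e.2 == e'.2)].

Definition incompatible (p q : u_index) : bool :=
  ~~ one_to_one (pi_map p :|: pi_map q).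

Definition some_u (C : {C : clause3 N | C \in phi}) : clause lift_var :=
  [set (uvar (C, t), true) | t : triple].

Definition not_both_u (p q : u_index) : clause lift_var :=
  [set (uvar p, false); (uvar q, false)].

Definition Phi2 : cnf lift_var :=
  [set some_u C | C : {C : clause3 N | C \in phi}]
  :|: [set not_both_u p q | p in u_index, q in u_index
        & (p.1 == q.1) && (p.2 != q.2)]
  :|: [set not_both_u p q | p in u_index, q in u_index & incompatible p q].

Definition Psi : cnf lift_var := Phi1 :|: Phi2.

End Lift.

(* Main.v *)
From HB Require Import structures.
Require Import Defs.
From mathcomp Require Import all_boot all_order all_algebra finmap.
From mathcomp Require Import reals exp.
From mathcomp Require Import mpoly.
From mathcomp Require Import sequences ring lra zify.
From mathcomp Require boolp.

Set Implicit Arguments.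
Unset Strict Implicit.
Unset Printing Implicit Defensive.

Import Order.TTheory GRing.Theory Num.Theory.
Local Open Scope ring_scope.

(** The order in which a given ordering of the variables of Psi lists
    v_1, ..., v_N determines a bijection tau from the v's to x_1 < ... < x_N.
    Substitute tau(v_i) for v_i, and for u_{C,i,j,k} the constant 1 if
    pi_{C,i,j,k} is contained in tau and the constant 0 otherwise.  Every
    polynomial of the translation of Psi then becomes 0 or a polynomial of the
    translation of phi, so a refutation of Psi becomes a refutation of phi in
    the ordering x_1 < ... < x_N.  Substituting constants does not increase the
    width of an roABP, and collecting the coefficients of axioms that become
    equal multiplies the width by at most the number of axioms of Psi, which is
    polynomial in N; this factor is absorbed by halving the exponent. *)

(** * Closure properties of bounded-width vector programs *)

Section VectorPrograms.

Variables (F : fieldType) (V : finType).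

Notation mpolyC := (@mpolyC #|V| F).

(* Unlike [abp_mx], the product ends with a constant vector. This makes the
   class closed under left multiplication by constant matrices, even when no
   variable is left to absorb them. *)
Fixpoint vec_computed (w : nat) (s : seq V) (b : nat)
    (v : 'cV[poly_ring F V]_b) : Prop :=
  (b <= w)%N /\
  match s with
  | [::] => exists k : 'cV[F]_b, v = map_mx mpolyC k
  | x :: s' => exists (b' : nat) (M : 'M[{poly F}]_(b, b'.+1)) v',
      vec_computed w s' v' /\ v = map_mx (horner_alg (pvar F x)) M *m v'
  end.

Lemma vec_computed_le w s b (v : 'cV_b) : vec_computed w s v -> (b <= w)%N.
Proof. by case: s => [|x s] []. Qed.

(** The constant matrix is absorbed into the first matrix, or into the final constant vector if no
    variable is left, so only the new number of rows has to respect [w]. *)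
Lemma vec_computed_mul w s m b (A : 'M[F]_(m, b)) (v : 'cV_b) :
  (m <= w)%N -> vec_computed w s v ->
  vec_computed w s (map_mx mpolyC A *m v).
Proof.
move=> le_mw; case: s => [|x s] /= [_].
  by case=> k ->; split=> //; exists (A *m k); rewrite map_mxM.
case=> b' [M [v' [v'P ->]]]; split=> //.
exists b', (map_mx polyC A *m M), v'; split=> //.
rewrite map_mxM mulmxA; congr (_ *m _ *m _).
by apply/matrixP=> i j; rewrite !mxE /= horner_algC alg_mpolyC.
Qed.

Lemma vec_computed_widen w w' s b (v : 'cV_b) :
  (w <= w')%N -> vec_computed w s v -> vec_computed w' s v.
Proof.
move=> le_ww'; elim: s b v => [|x s IHs] b v /= [le_bw H].
  by split=> //; apply: leq_trans le_ww'.
case: H => b' [M [v' [v'P vE]]]; split; first exact: leq_trans le_ww'.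
by exists b', M, v'; split=> //; apply: IHs.
Qed.

(** The two programs run in parallel with block-diagonal matrices. *)
Lemma vec_computed_col w1 w2 s b1 b2 (v1 : 'cV_b1) (v2 : 'cV_b2) :
  vec_computed w1 s v1 -> vec_computed w2 s v2 ->
  vec_computed (w1 + w2) s (col_mx v1 v2).
Proof.
elim: s b1 b2 v1 v2 => [|x s IHs] b1 b2 v1 v2 /= [le1 H1] [le2 H2];
  (split; first exact: leq_add).
  by case: H1 H2 => [k1 ->] [k2 ->]; exists (col_mx k1 k2); rewrite map_col_mx.
case: H1 H2 => [c1 [M1 [u1 [u1P ->]]]] [c2 [M2 [u2 [u2P ->]]]].
(* Inner dimensions are stored as predecessors: [c1.+1 + c2.+1] is [(c1 + c2.+1).+1]. *)
exists (c1 + c2.+1)%N, (block_mx M1 0 0 M2), (col_mx u1 u2).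
split; first exact: (IHs _ _ _ _ u1P u2P).
rewrite (@map_block_mx _ _ _ b1 b2 c1.+1 c2.+1) !map_mx0.
apply: esym; apply: etrans (@mul_block_col _ b1 b2 c1.+1 c2.+1 _ _ _ _ _ _ _) _.
by rewrite !mul0mx addr0 add0r.
Qed.

Definition computed (w : nat) (s : seq V) (p : poly_ring F V) : Prop :=
  vec_computed w s (p%:M : 'cV_1).

(** The sum is the constant row (1 1) times the stacked column. *)
Lemma computed_add w1 w2 s p1 p2 :
  computed w1 s p1 -> computed w2 s p2 -> computed (w1 + w2) s (p1 + p2).
Proof.
move=> p1P p2P; have := vec_computed_col p1P p2P.
move/(@vec_computed_mul _ _ 1 _ (row_mx 1%:M 1%:M)).
rewrite map_row_mx mul_row_col map_mx1 !mul1mx -raddfD; apply.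
by rewrite addn_gt0 (vec_computed_le p1P).
Qed.

Lemma computed0 s : computed 1 s 0.
Proof.
rewrite /computed; elim: s => [|x s IHs] /=; split=> //.
  by exists 0; rewrite map_mx0 raddf0.
by exists 0%N, 0, (0%:M); split=> //; rewrite map_mx0 mul0mx raddf0.
Qed.

(** The extra 1 in the width pays for the empty sum at the end of the list. *)
Lemma computed_sum w s (I : eqType) (r : seq I) (f : I -> poly_ring F V) :
  {in r, forall i, computed w s (f i)} ->
  computed (size r * w).+1 s (\sum_(i <- r) f i).
Proof.
elim: r => [|i r IHr] fP; first by rewrite big_nil; apply: computed0.
rewrite big_cons /= mulSn -addnS; apply: computed_add.
  by apply: fP; rewrite mem_head.
by apply: IHr => j jr; apply: fP; rewrite inE jr orbT.
Qed.

(** The final constant vector is multiplied into the last matrix, which is why [s] must be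
    nonempty. *)
Lemma vec_computed_abp w s a (v : 'cV_a.+1) : s != [::] ->
  vec_computed w s v ->
  exists2 P : abp F s a 0, abp_mx P = v & (abp_width P <= w)%N.
Proof.
elim: s a v => // x s IHs a v _ /= [le_aw [b [M [v' [v'P ->]]]]].
case: s IHs v'P => [_|y s IHs v'P].
  case=> le_bw [k ->].
  exists (AbpCons x (M *m map_mx polyC k) (AbpNil F V 0)) => /=; last first.
    by rewrite geq_max le_aw (leq_trans _ le_aw).
  rewrite mulmx1 map_mxM; congr (_ *m _).
  by apply/matrixP=> i j; rewrite !mxE /= horner_algC alg_mpolyC.
have [//|P PE Pw] := IHs b v' _ v'P.
by exists (AbpCons x M P); rewrite /= ?PE // geq_max le_aw.
Qed.

Lemma computed_roABP w s p : s != [::] -> computed w s p ->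
  exists2 P : roABP F s, roABP_poly P = p & (roABP_width P <= w)%N.
Proof.
move=> s_neq0 /(vec_computed_abp s_neq0)[P PE Pw].
by exists (RoABP P); rewrite // /roABP_poly /= PE mxE.
Qed.

End VectorPrograms.

(** * Substituting constants and variables in an roABP *)

Section Restriction.

Variables (F : fieldType) (V V' : finType) (sigma : V -> F + V').

Definition subst_var (x : V) : poly_ring F V' :=
  match sigma x with inl c => c%:MP_[#|V'|] | inr y => pvar F y end.

Definition subst : poly_ring F V -> poly_ring F V' :=
  mmap (@mpolyC #|V'| F) (fun i => subst_var (enum_val i)).

HB.instance Definition _ := GRing.RMorphism.on subst.

Lemma subst_pvar x : subst (pvar F x) = subst_var x.
Proof. by rewrite /subst mmapX mmap1U enum_rankK. Qed.

Lemma subst_horner x (m : {poly F}) :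
  subst (horner_alg (pvar F x) m) = horner_alg (subst_var x) m.
Proof.
elim/poly_ind: m => [|m c IHm]; first by rewrite !rmorph0.
rewrite !rmorphD !rmorphM /= IHm !horner_algX !horner_algC subst_pvar.
by rewrite !alg_mpolyC /subst mmapC.
Qed.

Definition rest (x : V) : option V' :=
  match sigma x with inl _ => None | inr y => Some y end.

(** A matrix whose variable becomes a constant turns into a constant matrix and is absorbed by the
    rest of the product; a matrix whose variable is renamed keeps its entries. *)
Lemma vec_computed_subst s a c (P : abp F s a c) (k : 'cV[F]_c.+1) w :
  (abp_width P <= w)%N ->
  vec_computed w (pmap rest s)
    (map_mx subst (abp_mx P) *m map_mx (@mpolyC #|V'| F) k).
Proof.
elim: P k => [{}a|x {}s {}a b {}c M P IHP] k /=.
  by move=> le_aw; split=> //; exists k; rewrite map_mx1 mul1mx.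
rewrite geq_max => /andP[le_aw le_Pw].
have := IHP k le_Pw; rewrite map_mxM -mulmxA -map_mx_comp.
rewrite /rest; case E: (sigma x) => [d|y] /= IH.
  set A := (X in X *m _).
  suff -> : A = map_mx (@mpolyC #|V'| F) (map_mx (horner_eval d) M).
    exact: vec_computed_mul.
  apply/matrixP=> i j; rewrite !mxE /= subst_horner /subst_var E.
  rewrite /horner_eval; elim/poly_ind: (M i j) => [|m e IHm].
    by rewrite !rmorph0 horner0 mpolyC0.
  rewrite !rmorphD !rmorphM /= horner_algX horner_algC IHm.
  by rewrite hornerMXaddC mpolyCD mpolyCM alg_mpolyC.
split=> //; exists b, M; eexists; split; first exact: IH.
congr (_ *m _); apply/matrixP=> i j.
by rewrite !mxE /= subst_horner /subst_var E.
Qed.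

Lemma computed_subst s (P : roABP F s) :
  computed (roABP_width P) (pmap rest s) (subst (roABP_poly P)).
Proof.
case: P => a c P; rewrite /roABP_width /roABP_poly /=.
(* Unit vectors on both sides extract the (1,1) entry. *)
have := vec_computed_subst (delta_mx 0 0) (leqnn (abp_width P)).
move/(@vec_computed_mul _ _ _ _ 1 _ (delta_mx 0 0)).
rewrite /computed; set v := _ *m _; set u := _%:M.
suff -> : v = u.
  by apply; case: {u v} P => //= *; rewrite leq_max.
apply/matrixP=> i j; rewrite !ord1 /v /u !map_delta_mx.
by rewrite -rowE -colE !mxE.
Qed.

End Restriction.

(** * Transfer of refutations along a substitution *)

Lemma subst_refutation (F : fieldType) (V V' : finType) (sigma : V -> F + V')
    (s : seq V) (Q : {fset poly_ring F V}) (Q' : {fset poly_ring F V'})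
    (r : refutation s Q) :
  pmap (rest sigma) s != [::] ->
  {in Q, forall q, subst sigma q = 0 \/ subst sigma q \in Q'} ->
  exists r' : refutation (pmap (rest sigma) s) Q',
    (ref_width r' <= (#|` Q| * ref_width r).+1)%N.
Proof.
set theta := subst sigma; move=> s_neq0 QQ'; set w := ref_width r.
(* Distinct axioms may have the same image [q']; their coefficients are added up. *)
pose g q' := \sum_(q <- [seq q <- Q | theta q == q']) theta (ref_coef r q).
have gP q' : exists P : roABP F (pmap (rest sigma) s),
    roABP_poly P = g q' /\ (roABP_width P <= (#|` Q| * w).+1)%N.
  have : computed (size [seq q <- Q | theta q == q'] * w).+1
      (pmap (rest sigma) s) (g q').
    apply: computed_sum => q; rewrite mem_filter => /andP[_ qQ].
    rewrite -(ref_computes r qQ).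
    apply: vec_computed_widen (computed_subst _ _).
    exact: (@leq_bigmax_seq _ _ _ (fun q => roABP_width (ref_roABP r q))).
  case/(computed_roABP s_neq0)=> P PE Pw; exists P; split=> //.
  apply: leq_trans Pw _.
  by rewrite ltnS leq_mul2r size_filter count_size orbT.
have [P PP] := boolp.choice gP.
have sum_g : \sum_(q' <- Q') g q' * q' = 1.
  rewrite -(rmorph1 theta) -(ref_sum r) rmorph_sum /=.
  under eq_bigr do rewrite mulr_suml big_filter.
  (* After the exchange, [q] contributes through the single [q'] equal to [theta q], or not at all
     if [theta q] is outside [Q'], hence 0. *)
  rewrite (exchange_big_dep xpredT) //=.
  rewrite big_seq [RHS]big_seq; apply: eq_bigr => q qQ.
  rewrite rmorphM /= -/theta; case: (boolP (theta q \in Q')) => [qQ'|nqQ'].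
    rewrite -big_filter (_ : [seq _ <- _ | _] = [:: theta q]) ?big_seq1 //.
    rewrite -(filter_pred1_uniq (fset_uniq Q') qQ').
    by apply: eq_filter => q'; rewrite eq_sym.
  have [q0|qQ'] := QQ' q qQ; last by rewrite qQ' in nqQ'.
  rewrite {2}q0 mulr0 big_seq_cond big1 // => q' /andP[q'Q' /eqP qq'].
  by rewrite qq' q'Q' in nqQ'.
exists (Refutation (fun q' _ => (PP q').1) sum_g).
by apply/bigmax_leqP_seq=> q' _ _; apply: (PP q').2.
Qed.

(** [Q] cannot be empty, as the empty sum is not 1, and every matrix dimension is positive. *)
Lemma ref_width_gt0 (F : fieldType) (V : finType) (s : seq V)
    (Q : {fset poly_ring F V}) (r : refutation s Q) : (0 < ref_width r)%N.
Proof.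
case: (fset_0Vmem Q) => [Q0|[q qQ]].
  move: r; rewrite Q0 => r; have /eqP := ref_sum r.
  by rewrite big_seq_fset0 eq_sym oner_eq0.
apply: leq_trans (@leq_bigmax_seq _ _ _
  (fun q => roABP_width (ref_roABP r q)) _ qQ _) => //.
by rewrite /roABP_width; case: (roABP_abp _) => //= *; rewrite leq_max.
Qed.

(** * Translated clauses under substitution *)

Section SubstTranslation.

Variables (F : fieldType) (V V' : finType) (sigma : V -> F + V').

Lemma subst_tr (C : clause V) :
  subst sigma (tr F C) =
  \prod_(l in C) (if sg l then 1 - subst_var sigma (var l)
                  else subst_var sigma (var l)).
Proof.
rewrite rmorph_prod; apply: eq_bigr => l _ /=.
by case: (sg l); rewrite ?rmorphB ?rmorph1 /= subst_pvar.
Qed.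

(** The constant makes [l] true, so the factor of [l] vanishes. *)
Lemma subst_tr_satisfied (C : clause V) (l : literal V) :
  l \in C -> sigma (var l) = inl (sg l)%:R -> subst sigma (tr F C) = 0.
Proof.
move=> lC sl; rewrite subst_tr (bigD1 l) //= /subst_var sl.
by case: (sg l); rewrite /= ?mpolyC1 ?mpolyC0 ?subrr mul0r.
Qed.

End SubstTranslation.

(** * The restriction of the lifted formula given by [tau] *)

Section LiftRestriction.

Variables (F : fieldType) (N : nat) (phi : {set clause3 N}).
Hypothesis phi_3cnf : forall C : clause3 N, C \in phi ->
  uniq [seq var l | l <- C].
Variable tau : 'I_N -> 'I_N.
Hypothesis tau_inj : injective tau.

Lemma var_tnth_inj (C : clause3 N) : C \in phi ->
  injective (fun k => var (tnth C k)).
Proof.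
move=> /phi_3cnf C_uniq.
have /tuple_uniqP inj : uniq (map_tuple (@var 'I_N) C) by [].
by move=> k k' E; apply: inj; rewrite !tnth_map.
Qed.

(** Containment of the partial map of [p] in the graph of [tau]. *)
Definition selected (p : u_index phi) : bool :=
  [forall k, tau (tnth (val p.2) k) == var (tnth (val p.1) k)].

Lemma selectedP (p : u_index phi) : reflect
  (forall k, tau (tnth (val p.2) k) = var (tnth (val p.1) k)) (selected p).
Proof. exact: 'forall_eqP. Qed.

Definition lift_subst (x : lift_var phi) : F + 'I_N :=
  match x with inl p => inl (selected p)%:R | inr i => inr (tau i) end.

Lemma selected_exists (C : {C : clause3 N | C \in phi}) :
  exists t : triple N, selected (C, t).
Proof.
(* The preimages of the three variables of [C]; they are distinct because those variables are. *)
pose t := [tuple invF tau_inj (var (tnth (val C) k)) | k < 3].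
have t_uniq : uniq t.
  apply/tuple_uniqP=> k k'; rewrite !tnth_mktuple.
  move=> /(can_inj (f_invF tau_inj)).
  exact: var_tnth_inj (valP C) _ _.
exists (exist _ t t_uniq); apply/selectedP => k /=.
by rewrite tnth_mktuple f_invF.
Qed.

Lemma selected_inj (p q : u_index phi) :
  selected p -> selected q -> p.1 = q.1 -> p = q.
Proof.
case: p q => [C t] [D t'] /selectedP /= ct /selectedP /= dt' CD.
congr (_, _) => //.
apply/val_inj/eq_from_tnth => k; apply: tau_inj.
by rewrite ct dt' CD.
Qed.

(** Both partial maps lie in the graph of the injective [tau], so their union is one-to-one. *)
Lemma selected_compatible (p q : u_index phi) :
  selected p -> selected q -> ~~ incompatible p q.
Proof.
move=> /selectedP pP /selectedP qP; rewrite negbK.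
have graph e : e \in pi_map p :|: pi_map q -> e.2 = tau e.1.
  by case/setUP=> /imsetP[k _ ->] /=; rewrite ?pP ?qP.
apply/forall_inP=> e /graph ->; apply/forall_inP=> e' /graph ->.
by rewrite (inj_eq tau_inj).
Qed.

Lemma subst_not_both_u (p q : u_index phi) : ~~ (selected p && selected q) ->
  subst lift_subst (tr F (not_both_u p q)) = 0.
Proof.
rewrite negb_and => /orP[] /negbTE sel.
  by apply: (@subst_tr_satisfied _ _ _ _ _ (uvar p, false));
    rewrite ?inE ?eqxx //= sel.
by apply: (@subst_tr_satisfied _ _ _ _ _ (uvar q, false));
  rewrite ?inE ?eqxx ?orbT //= sel.
Qed.

(** If [p] is not selected, its negated [u] literal is true; if it is, that literal contributes the
    factor 1 and [tau] renames the others to the literals of the original clause. *)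
Lemma subst_Phi1_clause (p : u_index phi) :
  subst lift_subst (tr F (Phi1_clause p)) =
  (selected p)%:R * tr F [set l in val p.1].
Proof.
case: (boolP (selected p)) => [pP|/negbTE pP]; last first.
  rewrite mul0r; apply: (@subst_tr_satisfied _ _ _ _ _ (uvar p, false)) => /=.
    by rewrite !inE eqxx.
  by rewrite pP.
rewrite mul1r subst_tr big_setU1 /=; last first.
  by apply/negP=> /imsetP[k _].
rewrite /subst_var /= pP mpolyC1 mul1r.
move/selectedP: pP => pP.
rewrite big_imset /=; last first.
  by have /tuple_uniqP inj := valP p.2; move=> k k' _ _ [] /inj.
have -> : [set l in val p.1] = [set tnth (val p.1) k | k : 'I_3].
  by apply/setP=> l; rewrite inE; apply/tnthP/imsetP => -[k]; exists k.
rewrite /tr big_imset /=; last first.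
  by move=> k k' _ _ E; apply: (var_tnth_inj (valP p.1)); rewrite E.
by apply: eq_bigr => k _; rewrite pP.
Qed.

Lemma subst_translation (q : poly_ring F (lift_var phi)) :
  q \in translation F (Psi phi) ->
  subst lift_subst q = 0 \/ subst lift_subst q \in translation F (cnf_of phi).
Proof.
case/fsetUP=> /imfsetP[] /=.
  move=> D DPsi ->; move: DPsi; rewrite !inE.
  case/or3P=> [|/orP[]|].
  - case/imsetP=> p _ ->; rewrite subst_Phi1_clause.
    case: (selected p); [right|left]; last by rewrite mul0r.
    rewrite mul1r; apply/orP; left; apply/imfsetP.
    exists [set l in val p.1] => //.
    by apply/imsetP; exists (val p.1); rewrite ?(valP p.1).
  - case/imsetP=> C _ ->; left; have [t sel] := selected_exists C.
    apply: (@subst_tr_satisfied _ _ _ _ _ (uvar (C, t), true)).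
      by apply/imsetP; exists t.
    by rewrite /= sel.
  - case/imset2P=> p q' _; rewrite inE => /andP[_ /andP[/eqP e1 /eqP ne2] ->].
    left; apply: subst_not_both_u; apply/negP=> /andP[sp sq].
    by apply: ne2; rewrite (selected_inj sp sq e1).
  - case/imset2P=> p q' _; rewrite inE => /andP[_ inc ->].
    left; apply: subst_not_both_u; apply/negP=> /andP[sp sq].
    by move: inc; apply/negP/selected_compatible.
(* Boolean axioms: 0 and 1 satisfy that of a [u] variable, and that of [v_i] becomes that of
   [tau i]. *)
move=> [p|i] _ ->; rewrite rmorphB rmorphXn /= subst_pvar /subst_var /=.
  by left; case: (selected p); rewrite ?mpolyC1 ?mpolyC0 ?expr1n ?expr0n subrr.
right; rewrite /translation in_fsetU; apply/orP; right; apply/imfsetP.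
by exists (tau i).
Qed.

End LiftRestriction.

(** [tau] sends each [v_i] to its position among the [v] variables in [s], so the images appear in
    increasing order. *)
Lemma ordering_restriction (F : fieldType) (N : nat) (phi : {set clause3 N})
    (s : seq (lift_var phi)) : is_ordering s ->
  exists2 tau : 'I_N -> 'I_N, injective tau &
    pmap (rest (@lift_subst F N phi tau)) s = enum 'I_N.
Proof.
move=> s_ord.
pose getv (x : lift_var phi) := if x is inr i then Some i else None.
have getvK : ocancel getv inr by case.
pose vs := pmap getv s.
have vs_uniq : uniq vs.
  by rewrite (pmap_uniq getvK) // (perm_uniq s_ord) enum_uniq.
have vs_mem i : i \in vs.
  rewrite mem_pmap -[Some i]/(getv (inr i)) map_f //.
  by rewrite (perm_mem s_ord) mem_enum.
have vs_size : size vs = N.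
  rewrite -[RHS]size_enum_ord; apply/perm_size/uniq_perm; rewrite ?enum_uniq //.
  by move=> i; rewrite vs_mem mem_enum.
have tauP i : (index i vs < N)%N by rewrite -[X in (_ < X)%N]vs_size index_mem.
have [tau tauE] :
    exists tau : 'I_N -> 'I_N, forall i, tau i = index i vs :> nat.
  by exists (fun i => Ordinal (tauP i)).
exists tau.
  by move=> i j /(congr1 val); rewrite /= !tauE => /index_inj; apply.
rewrite (_ : pmap _ s = map tau vs); last first.
  by rewrite /vs; elim: (s) => //= -[p|i] s' //= ->.
apply: (inj_map val_inj); rewrite val_enum_ord -map_comp -[in RHS]vs_size.
apply: (@eq_from_nth _ 0%N); rewrite size_map ?size_iota // => k lt_k.
(* A default for [nth]: [vs] is nonempty, since [k] is below its size. *)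
have i0 : 'I_N by case: vs lt_k {vs_uniq vs_mem vs_size tauP tauE}.
by rewrite (nth_map i0) //= nth_iota // tauE index_uniq.
Qed.

(** * Counting the axioms and absorbing a polynomial factor *)

Lemma card_u_index (N : nat) (phi : {set clause3 N}) :
  (#|{: u_index phi}| <= 8 * N ^ 6)%N.
Proof.
rewrite card_prod (_ : 8 * N ^ 6 = (N * 2) ^ 3 * N ^ 3)%N; last first.
  by rewrite expnMn mulnAC -expnD mulnC.
apply: leq_mul.
  rewrite card_sig; apply: leq_trans (max_card _) _.
  by rewrite card_tuple card_prod card_ord card_bool.
rewrite card_sig; apply: leq_trans (max_card _) _.
by rewrite card_tuple card_ord.
Qed.

Lemma card_translation (F : fieldType) (V : finType) (f : cnf V) :
  (#|` translation F f| <= #|f| + #|V|)%N.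
Proof.
apply: leq_trans (leq_card_fsetU _ _) _; apply: leq_add.
  by apply: leq_trans (leq_imfset_card _ _ _) _; rewrite cardE.
by apply: leq_trans (leq_imfset_card _ _ _) _; rewrite cardE.
Qed.

Lemma card_Psi (N : nat) (phi : {set clause3 N}) :
  (#|Psi phi| <= 2 * #|{: u_index phi}| ^ 2 + #|{: u_index phi}| + #|phi|)%N.
Proof.
set U := #|{: u_index phi}|.
have card_pairs (P : rel (u_index phi)) :
    (#|[set not_both_u p q | p in u_index phi, q in u_index phi & P p q]|
       <= U ^ 2)%N.
  pose B := [set not_both_u x.1 x.2 | x : u_index phi * u_index phi].
  apply: (@leq_trans #|B|).
    apply/subset_leq_card/subsetP=> D /imset2P[p q _ _ ->].
    by apply/imsetP; exists (p, q).
  by apply: leq_trans (leq_imset_card _ _) _; rewrite card_prod.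
have cardU (T : finType) (A B : {set T}) a b :
    (#|A| <= a -> #|B| <= b -> #|A :|: B| <= a + b)%N.
  by move=> leA leB; apply: leq_trans (leq_card_setU A B) _; apply: leq_add.
apply: (@leq_trans (U + (#|phi| + U ^ 2 + U ^ 2))%N); last by lia.
apply: (cardU); first exact: leq_imset_card.
apply: (cardU _ _ _ _ _ _ (card_pairs _)).
apply: (cardU _ _ _ _ _ _ (card_pairs _)).
by apply: leq_trans (leq_imset_card _ _) _; rewrite card_sig.
Qed.

(** With [y] = N^(eps/2), taking logarithms leaves d ln N + y ln 2 <= y^2 ln 2. As ln N <= (2/eps)
    y, it suffices that [y] is at least [c]. *)
Lemma exp_beats_poly (R : realType) (eps : R) (d : nat) : 0 < eps ->
  exists N0 : nat, forall N : nat, (N0 <= N)%N ->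
    N%:R ^+ d * 2 `^ (N%:R `^ (eps / 2)) <= 2 `^ (N%:R `^ eps) :> R.
Proof.
move=> eps_gt0; have ln2_gt0 : 0 < ln 2 :> R by rewrite ln_gt0 // ltr1n.
pose c : R := d%:R * 2 / (eps * ln 2) + 1.
(* This threshold forces (eps/2) ln N >= [c], and the left side is at most [y]. *)
exists (Num.bound (expR (2 / eps * c))) => N leN.
have N_ge : expR (2 / eps * c) <= N%:R.
  apply: ltW; apply: lt_le_trans (archi_boundP (expR_ge0 _)) _.
  by rewrite ler_nat.
have N_gt0 : 0 < N%:R :> R by apply: lt_le_trans N_ge; exact: expR_gt0.
set L := ln (N%:R : R).
have L_ge : 2 / eps * c <= L by rewrite -[leLHS]expRK ler_ln ?posrE ?expR_gt0.
set y := N%:R `^ (eps / 2).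
have yE : y = expR (eps / 2 * L) by rewrite /y /powR gt_eqF.
have y2E : N%:R `^ eps = y ^+ 2.
  by rewrite yE -expRM_natl /powR gt_eqF // -/L; congr expR; field.
have y_ge : eps / 2 * L <= y.
  by rewrite yE; apply: le_trans (expR_ge1Dx _); rewrite lerDr.
have c_le : c <= y.
  apply: le_trans y_ge; rewrite -(ler_pM2l (_ : 0 < 2 / eps)) ?divr_gt0 //.
  apply: le_trans L_ge _; rewrite le_eqVlt; apply/orP; left; apply/eqP.
  by field; rewrite gt_eqF.
rewrite y2E /powR !pnatr_eq0 /= -[in N%:R ^+ d](lnK N_gt0).
rewrite -expRM_natl -expRD ler_expR -/L.
have y_gt0 : 0 < y by rewrite yE expR_gt0.
have : d%:R * L <= (c - 1) * y * ln 2.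
  rewrite (_ : (c - 1) * y * ln 2 = d%:R * (2 / eps * y)); last first.
    by rewrite /c; field; rewrite !gt_eqF.
  rewrite ler_wpM2l // -(ler_pM2l (_ : 0 < eps / 2)) ?divr_gt0 //.
  apply: le_trans y_ge _; rewrite le_eqVlt; apply/orP; left; apply/eqP.
  by field; rewrite gt_eqF.
have : c * y * ln 2 <= y ^+ 2 * ln 2.
  by rewrite ler_pM2r // expr2 ler_pM2r.
lra.
Qed.

(** The count is at most 2U^2 + 2U + |phi| + N, hence at most (128 + 16 + 8 + 1) N^12 = 153 N^12,
    which is strictly below 154 N^12. *)
Lemma card_translation_Psi (F : fieldType) (N : nat) (phi : {set clause3 N}) :
  (154 <= N)%N -> (#|` translation F (Psi phi)| < N ^ 13)%N.
Proof.
move=> N_ge; have N_gt0 : (0 < N)%N by apply: leq_trans N_ge.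
have := leq_trans (card_translation F (Psi phi))
  (leq_add (card_Psi phi) (leqnn _)).
set K := #|` _|; move: K => K.
rewrite card_sum card_ord; have := card_u_index phi.
set U := #|{: u_index phi}| => leU leK.
have le_phi : (#|phi| <= 8 * N ^ 3)%N.
  apply: leq_trans (max_card _) _.
  by rewrite card_tuple card_prod card_ord card_bool expnMn mulnC.
have leU2 : (U ^ 2 <= 64 * N ^ 12)%N.
  by rewrite (_ : 64 * _ = (8 * N ^ 6) ^ 2)%N ?leq_sqr // expnMn -expnM.
have pow k : (k <= 12)%N -> (N ^ k <= N ^ 12)%N by move=> ?; rewrite leq_pexp2l.
have := pow 0%N isT; have := pow 1%N isT.
have := pow 3%N isT; have := pow 6%N isT.
have : (154 * N ^ 12 <= N ^ 13)%N by rewrite (expnS N 12) leq_mul2r N_ge orbT.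
rewrite expn0 expn1.
move: (N ^ 13)%N (N ^ 12)%N (N ^ 6)%N (N ^ 3)%N (U ^ 2)%N leU leK le_phi leU2.
by move=> *; lia.
Qed.

Theorem theorem4p4 (F : fieldType) (R : realType)
    (fam : forall N : nat, {set clause3 N} -> Prop)
    (fam_3cnf : forall (N : nat) (phi : {set clause3 N}), fam N phi ->
       forall C : clause3 N, C \in phi -> uniq [seq var l | l <- C])
    (fam_unsat : forall (N : nat) (phi : {set clause3 N}), fam N phi ->
       unsatisfiable (cnf_of phi))
    (fam_hard : exists2 eps : R, 0 < eps &
       exists N0 : nat, forall (N : nat) (phi : {set clause3 N}),
         (N0 <= N)%N -> fam N phi ->
         forall r : refutation (enum 'I_N) (translation F (cnf_of phi)),
           2 `^ (N%:R `^ eps) <= (ref_width r)%:R) :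
  exists2 eps : R, 0 < eps &
    exists N0 : nat, forall (N : nat) (phi : {set clause3 N}),
      (N0 <= N)%N -> fam N phi ->
      forall s : seq (lift_var phi), is_ordering s ->
      forall r : refutation s (translation F (Psi phi)),
        2 `^ (N%:R `^ eps) <= (ref_width r)%:R.
Proof.
case: fam_hard => eps eps_gt0 [N0 hard].
have [N1 beats] := exp_beats_poly 13 eps_gt0.
exists (eps / 2); first by rewrite divr_gt0.
exists (maxn 154 (maxn N0 N1)) => N phi; rewrite !geq_max.
case/and3P=> N_ge N0_le N1_le famphi s s_ord r.
have [tau tau_inj tauE] := ordering_restriction F s_ord.
have phi_3cnf := fam_3cnf N phi famphi.
have [r' r'_le] :
    exists r' : refutation (enum 'I_N) (translation F (cnf_of phi)),
    (ref_width r' <= (#|` translation F (Psi phi)| * ref_width r).+1)%N.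
  rewrite -tauE; apply: subst_refutation.
    by rewrite tauE -size_eq0 size_enum_ord -lt0n (leq_trans _ N_ge).
  by move=> q; apply: subst_translation.
have N_gt0 : 0 < N%:R ^+ 13 :> R.
  by rewrite exprn_gt0 // ltr0n (leq_trans _ N_ge).
(* Both sides are multiplied by N^13, the bound on the number of axioms. *)
rewrite -(ler_pM2l N_gt0); apply: le_trans (beats N N1_le) _.
apply: le_trans (hard N phi N0_le famphi r') _.
rewrite -natrX -natrM ler_nat; apply: leq_trans r'_le _.
(* The strict bound on the number of axioms leaves one spare copy of the width, which is at least 1
   and covers the successor. *)
apply: leq_trans (leq_mul (card_translation_Psi F phi N_ge) (leqnn _)).
by rewrite mulSn -add1n leq_add2r ref_width_gt0.
Qed.
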